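(* The probability distribution function of $V(k)$ is given by $$P(V(k)=v)=h_{v-k+1}\,\alpha^{k-1},$$ where $$h_v=\beta h_{v-1}+(1-\alpha)(1-\beta)\sum_{i=0}^{k-2}\alpha^i h_{v-i-2}\qquad\text{for } v=k+1,k+2,\dots,$$ with $h_1=p$, $h_2=q(1-\beta)$, $h_3=\beta h_2+(1-\alpha)(1-\beta)h_1$, $h_4=\beta h_3+(1-\alpha)(1-\beta)h_2+\alpha(1-\alpha)(1-\beta)h_1$, $\dots$, and $$h_k=\beta h_{k-1}+(1-\alpha)(1-\beta)\sum_{i=0}^{k-3}\alpha^i h_{k-i-2}.$$
   Context: $(X_i)_{i\ge1}$ is an infinite sequence of two-state ($0$/$1$) Markov dependent Bernoulli trials with $P(X_i=1)=p$, $P(X_i=0)=1-p=q$, and, for $i>1$, $P(X_i=1\mid X_{i-1}=1)=\alpha$ and $P(X_i=0\mid X_{i-1}=0)=\beta$. $V(k)$ is the waiting time (number of trials needed) to get $k$ consecutive ones for the first time. *)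

(* Defs.v *)
From HB Require Import structures.
From mathcomp Require Import all_boot all_order all_algebra.
From mathcomp Require Import all_classical all_reals all_analysis.

Set Implicit Arguments.
Unset Strict Implicit.
Unset Printing Implicit Defensive.

Import Order.TTheory GRing.Theory Num.Theory.

Local Open Scope classical_set_scope.
Local Open Scope ring_scope.

(* Only meaningful when P B != 0 (it is 0 otherwise); every use below is
   guarded by that condition. *)
Definition cond_prob (d : measure_display) (T : measurableType d)
    (R : realType) (P : probability T R) (A B : set T) : R :=
  fine (P (A `&` B)) / fine (P B).

(* States 1 and 0 are [true] and [false].  Trials are X 1, X 2, ...; X 0 is
   unconstrained and never used.  The law p is only required of the first
   trial: P(X_i = 1) = p for every i would force p = p alpha + (1-p)(1-beta)
   (stationarity), which is a special case.  P(X_1 = 0) = 1 - p is implied. *)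
Definition markov_bernoulli_trials (d : measure_display)
    (T : measurableType d) (R : realType) (P : probability T R)
    (p alpha beta : R) (X : nat -> {RV P >-> bool}) : Prop :=
  [/\ P [set w | X 1%N w = true] = p%:E,
      (forall i : nat, (1 < i)%N ->
         P [set w | X i.-1 w = true] != 0%E ->
         cond_prob P [set w | X i w = true] [set w | X i.-1 w = true] = alpha),
      (forall i : nat, (1 < i)%N ->
         P [set w | X i.-1 w = false] != 0%E ->
         cond_prob P [set w | X i w = false] [set w | X i.-1 w = false] = beta)
    & (* Markov property *)
      (forall (i : nat) (x : nat -> bool), (1 < i)%N ->
         let past := [set w | forall j : nat, (1 <= j < i)%N -> X j w = x j] in
         P past != 0%E ->
         cond_prob P [set w | X i w = x i] past =
         cond_prob P [set w | X i w = x i] [set w | X i.-1 w = x i.-1])].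

(* x (n - k + 1) = ... = x n = 1, all these indices being at least 1. *)
Definition ones_run_at (k : nat) (x : nat -> bool) (n : nat) : bool :=
  (k <= n)%N && [forall i : 'I_k, x (n - i)%N].

(* [None] when k consecutive ones never occur. *)
Definition waiting_time (k : nat) (x : nat -> bool) : option nat :=
  match pselect (exists n, ones_run_at k x n) with
  | left ex => Some (ex_minn ex)
  | right _ => None
  end.

(* The values of h 1 and h 2 take precedence over the recurrences, which start
   at v = 3: for k = 1, resp. k = 2, the recurrence for v > k at v = 2, resp.
   the one for v <= k at v = 2, would contradict h 2.  The value h 0 is
   irrelevant. *)
Definition run_recurrence (R : realType) (p alpha beta : R) (k : nat)
    (h : nat -> R) : Prop :=
  let q := 1 - p in
  [/\ h 1%N = p,
      h 2%N = q * (1 - beta),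
      (forall v : nat, (3 <= v <= k)%N ->
         h v = beta * h v.-1 + (1 - alpha) * (1 - beta) *
               \sum_(0 <= i < v - 2) alpha ^+ i * h (v - i - 2)%N)
    & (forall v : nat, (3 <= v)%N -> (k + 1 <= v)%N ->
         h v = beta * h v.-1 + (1 - alpha) * (1 - beta) *
               \sum_(0 <= i < k - 1) alpha ^+ i * h (v - i - 2)%N)].

(* Main.v *)
(* Let h_v be the probability that a run of ones starts at trial v while no k
   consecutive ones occurred before, and g_v the probability that trial v is a
   zero and no k consecutive ones occurred by then.  By the Markov property
   h_{v+1} = (1 - beta) g_v, and V(k) = v means that such a run starts at trial
   v - k + 1 and is prolonged k - 1 times, which has probability
   h_{v-k+1} alpha^(k-1).  Sorting the event of g_{v+1} by the length i + 1 of
   the run of ones ending at trial v gives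
   g_{v+1} = beta g_v + (1 - alpha) sum_i alpha^i h_{v-i}; multiplying by
   1 - beta yields the recurrence. *)
Require Import Defs.
From HB Require Import structures.
From mathcomp Require Import all_boot all_order all_algebra.
From mathcomp Require Import all_classical all_reals all_analysis.
From mathcomp Require Import ring zify.

Set Implicit Arguments.
Unset Strict Implicit.
Unset Printing Implicit Defensive.

Import Order.TTheory GRing.Theory Num.Theory.

Local Open Scope classical_set_scope.
Local Open Scope ring_scope.

(** * Runs of ones in a fixed 0/1 sequence *)

(** Coordinate 0 is excluded since trials are numbered from 1. The hypothesis is symmetric in [x]
    and [y], so one implication already gives [Q x = Q y]. *)
Definition depends_upto (n : nat) (Q : (nat -> bool) -> bool) : Prop :=
  forall x y : nat -> bool,
    (forall j, (1 <= j <= n)%N -> x j = y j) -> Q x -> Q y.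

Definition no_run (k n : nat) (x : nat -> bool) : bool :=
  [forall e : 'I_n.+1, ~~ ones_run_at k x e].

(* Trials n-m+1, ..., n are ones and start a run (trial n-m is a zero or does
   not exist), and no k consecutive ones occurred by trial n-m. *)
Definition fresh_ones (k m n : nat) (x : nat -> bool) : bool :=
  [&& no_run k (n - m) x, (n == m) || ~~ x (n - m)%N & ones_run_at m x n].

(** Positions in the interval from n - m + 1 to n replace the offsets [n - i], which turns side
    conditions on indices into linear arithmetic. *)
Lemma ones_run_atP (m : nat) (x : nat -> bool) (n : nat) :
  reflect ((m <= n)%N /\ forall i, (n - m < i <= n)%N -> x i)
          (ones_run_at m x n).
Proof.
apply: (iffP andP) => -[le_mn H]; split=> //.
  move=> i i_in; have lt_im : (n - i < m)%N by lia.
  by have := forallP H (Ordinal lt_im); rewrite /= subKn //; lia.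
by apply/forallP => -[i lt_im] /=; apply: H; lia.
Qed.

Lemma no_runP (k n : nat) (x : nat -> bool) :
  reflect (forall e, (e <= n)%N -> ~~ ones_run_at k x e) (no_run k n x).
Proof.
apply: (iffP forallP) => H e.
  by rewrite -ltnS => lt_en; exact: (H (Ordinal lt_en)).
by apply: H; rewrite -ltnS.
Qed.

Lemma ones_run_at1 (x : nat -> bool) (n : nat) :
  (0 < n)%N -> ones_run_at 1 x n = x n.
Proof.
move=> n_gt0; apply/ones_run_atP/idP => [[_ H]|xn]; first by apply: H; lia.
by split=> // i i_in; have -> : i = n by lia.
Qed.

Lemma ones_run_atS (m : nat) (x : nat -> bool) (n : nat) :
  ones_run_at m.+1 x n.+1 = ones_run_at m x n && x n.+1.
Proof.
apply/ones_run_atP/andP => [[le_mn H]|[/ones_run_atP[le_mn H] xn]].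
  by split; [apply/ones_run_atP; split=> // i i_in|]; apply: H; lia.
split=> // i i_in; have [->//|ne_in] := eqVneq i n.+1; apply: H; lia.
Qed.

(** A run of k ones ending after n - m but before n - m + k would contain trial n - m, which is a
    zero or does not exist. *)
Lemma fresh_ones_no_run (k m n : nat) (x : nat -> bool) (e : nat) :
  fresh_ones k m n x -> (e < n - m + k)%N -> ~~ ones_run_at k x e.
Proof.
move=> /and3P[/no_runP no_run_nm start _] lt_e.
have [/no_run_nm//|gt_e] := leqP e (n - m).
apply/ones_run_atP => -[le_ke H]; case/orP: start => [/eqP|/negP]; first lia.
by apply; apply: H; lia.
Qed.

Lemma fresh_onesS (k m n : nat) (x : nat -> bool) :
  fresh_ones k m.+1 n.+1 x = fresh_ones k m n x && x n.+1.
Proof. by rewrite /fresh_ones subSS eqSS ones_run_atS !andbA. Qed.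

Lemma fresh_ones_short (k m n : nat) (x : nat -> bool) :
  (n < m)%N -> fresh_ones k m n x = false.
Proof.
by move=> lt_nm; apply/negP => /and3P[_ _ /andP[]]; rewrite leqNgt lt_nm.
Qed.

(** If the first completed run of k ones ends at v, then trial v - k cannot be a one: otherwise k
    consecutive ones would already end at v - 1. *)
Lemma waiting_timeE (k v : nat) (x : nat -> bool) : (0 < k)%N ->
  (waiting_time k x = Some v) <-> fresh_ones k k v x.
Proof.
move=> k_gt0; split.
  rewrite /waiting_time; case: pselect => // ex [<-].
  case: ex_minnP => n run_n min_n; have /ones_run_atP[le_kn H] := run_n.
  have no_run_lt e : (e < n)%N -> ~~ ones_run_at k x e.
    by move=> lt_en; apply/negP => /min_n; lia.
  apply/and3P; split=> //; first by apply/no_runP => e le_e; apply: no_run_lt; lia.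
  have [//|ne_nk] := eqVneq; apply/negP => x_nk.
  have /negP := no_run_lt n.-1 ltac:(lia); apply; apply/ones_run_atP.
  split=> [|i i_in]; first lia.
  by have [->//|ne_i] := eqVneq i (n - k)%N; apply: H; lia.
move=> fr; have /and3P[_ _ run_v] := fr.
have /ones_run_atP[le_kv _] := run_v.
rewrite /waiting_time; case: pselect => [ex|[]]; last by exists v.
case: ex_minnP => n run_n /(_ _ run_v) le_nv; congr Some; apply/eqP.
rewrite eqn_leq le_nv leqNgt; apply: contraL run_n => lt_nv.
by apply: (fresh_ones_no_run fr); lia.
Qed.

(** A final block of exactly m < k ones is too short to complete a run, so the absence of runs up to
    n reduces to their absence up to n - m. *)
Lemma no_run_ones_fresh (k m n : nat) (x : nat -> bool) : (m < k)%N ->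
  (no_run k n x && ones_run_at m x n) && ~~ ones_run_at m.+1 x n =
  fresh_ones k m n x.
Proof.
move=> lt_mk; apply/andP/idP => [[/andP[/no_runP nr run] nrun]|fr].
  have /ones_run_atP[le_mn H] := run.
  apply/and3P; split=> //; first by apply/no_runP => e le_e; apply: nr; lia.
  have [//|ne_nm] := eqVneq; apply: contraNN nrun => x_nm.
  apply/ones_run_atP; split=> [|i i_in]; first lia.
  by have [->//|ne_i] := eqVneq i (n - m)%N; apply: H; lia.
have /and3P[_ start run] := fr; have /ones_run_atP[le_mn _] := run.
split.
  rewrite run andbT; apply/no_runP => e le_en.
  by apply: (fresh_ones_no_run fr); lia.
apply/ones_run_atP => -[lt_mn H]; case/orP: start => [/eqP|/negP]; first lia.
by apply; apply: H; lia.
Qed.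

Lemma no_run_ones_longer (k m n : nat) (x : nat -> bool) :
  (no_run k n x && ones_run_at m x n) && ones_run_at m.+1 x n =
  no_run k n x && ones_run_at m.+1 x n.
Proof.
rewrite -andbA; congr andb; apply: andb_idl => /ones_run_atP[lt_mn H].
by apply/ones_run_atP; split=> [|i i_in]; [lia|apply: H; lia].
Qed.

(** A nonempty run of ones cannot end at a zero. *)
Lemma no_run_zeroE (k n : nat) (x : nat -> bool) : (0 < k)%N ->
  no_run k n.+1 x && ~~ x n.+1 = no_run k n x && ~~ x n.+1.
Proof.
move=> k_gt0; apply/andP/andP => -[/no_runP nr xn]; split=> //.
  by apply/no_runP => e le_e; apply: nr; lia.
apply/no_runP => e; rewrite leq_eqVlt => /predU1P[->|]; last exact: nr.
by apply: contra xn => /ones_run_atP[le_kn]; apply; lia.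
Qed.

(** With an empty block of ones, [fresh_ones] becomes the event whose probability is g_n. *)
Lemma fresh_ones0 (k n : nat) (x : nat -> bool) : (0 < n)%N ->
  fresh_ones k 0 n x = no_run k n x && ~~ x n.
Proof.
move=> n_gt0; rewrite /fresh_ones subn0 eqn0Ngt n_gt0 /=.
have -> : ones_run_at 0 x n; last by rewrite andbT.
by apply/ones_run_atP; split=> // i; lia.
Qed.

(** * Predicates determined by the first n trials *)

Lemma depends_upto_ones_run (n m e : nat) : (e <= n)%N ->
  depends_upto n (fun x => ones_run_at m x e).
Proof.
move=> le_en x y eq_xy /ones_run_atP[le_me H]; apply/ones_run_atP; split=> //.
by move=> i i_in; rewrite -eq_xy; [apply: H|lia].
Qed.

Lemma depends_upto_no_run (n k : nat) : depends_upto n (no_run k n).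
Proof.
move=> x y eq_xy /no_runP nr; apply/no_runP => e le_en.
apply: contra (nr e le_en); apply: (depends_upto_ones_run le_en) => j j_in.
by rewrite eq_xy.
Qed.

Lemma depends_upto_fresh_ones (n k m : nat) :
  depends_upto n (fresh_ones k m n).
Proof.
move=> x y eq_xy /and3P[nr start run]; apply/and3P; split.
- by apply: depends_upto_no_run nr => j j_in; apply: eq_xy; lia.
- have /ones_run_atP[le_mn _] := run; have [//|ne_nm] := eqVneq.
  by case/orP: start => [/eqP|]; [lia|rewrite eq_xy; last lia].
- exact: (depends_upto_ones_run (leqnn n) eq_xy).
Qed.

Lemma depends_upto_and (n : nat) (Q Q' : (nat -> bool) -> bool) :
  depends_upto n Q -> depends_upto n Q' ->
  depends_upto n (fun x => Q x && Q' x).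
Proof.
by move=> dQ dQ' x y eq_xy /andP[/(dQ _ _ eq_xy)-> /(dQ' _ _ eq_xy)->].
Qed.

Lemma depends_upto_neg (n : nat) (Q : (nat -> bool) -> bool) :
  depends_upto n Q -> depends_upto n (fun x => ~~ Q x).
Proof.
move=> dQ x y eq_xy; apply: contra; apply: dQ => j j_in.
by rewrite eq_xy.
Qed.

Lemma depends_upto_coord (n j : nat) (b : bool) : (1 <= j <= n)%N ->
  depends_upto n (fun x => x j == b).
Proof. by move=> j_in x y <-. Qed.

(** * Measurability and probability of events determined by finitely many trials *)

Section PathProbability.
Context (d : measure_display) (T : measurableType d) (R : realType).
Context (P : probability T R) (X : nat -> {RV P >-> bool}).
Implicit Types Q : (nat -> bool) -> bool.

Definition path_event Q : set T := [set w | Q (fun i => X i w)].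
Definition path_prob Q : R := fine (P (path_event Q)).

Lemma measurable_coord (i : nat) (b : bool) : measurable [set w | X i w = b].
Proof. by rewrite -[X in measurable X]/(X i @^-1` [set b]); exact: measurable_funPTI. Qed.

(** By induction on n: split on the value of trial n + 1 and overwrite that coordinate by the value,
    which leaves predicates of the first n trials. For n = 0 the predicate is constant, so its value
    at any one sequence decides. *)
Lemma measurable_path_event (n : nat) Q :
  depends_upto n Q -> measurable (path_event Q).
Proof.
elim: n Q => [|n IHn] Q dQ.
  have [Qt|nQt] := boolP (Q xpredT).
    rewrite (_ : path_event Q = setT) //; apply/seteqP; split=> // w _.
    by apply: dQ Qt => j; lia.
  rewrite (_ : path_event Q = set0) //; apply/seteqP; split=> // w Qw.
  by apply: (negP nQt); apply: dQ Qw => j; lia.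
pose upd b (x : nat -> bool) i := if i == n.+1 then b else x i.
have upd_id x : upd (x n.+1) x = x.
  by apply/funext => i; rewrite /upd; case: eqP => // ->.
have dupd b : depends_upto n (fun x => Q (upd b x)).
  move=> x y eq_xy; apply: dQ => j j_in; rewrite /upd.
  by case: eqP => // ne_j; apply: eq_xy; lia.
rewrite (_ : path_event Q =
    ([set w | X n.+1 w = true] `&` path_event (fun x => Q (upd true x))) `|`
    ([set w | X n.+1 w = false] `&` path_event (fun x => Q (upd false x)))).
  by apply: measurableU; apply: measurableI;
    [exact: measurable_coord|exact: IHn (dupd _)
    |exact: measurable_coord|exact: IHn (dupd _)].
apply/seteqP; split=> w; rewrite /path_event /=.
  move=> Qw; have := upd_id (fun i => X i w).
  by case E: (X n.+1 w) => eq_w; [left|right]; rewrite eq_w.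
by case=> -[Xw]; rewrite -[in X in _ -> X](upd_id (fun i => X i w)) Xw.
Qed.

Lemma eq_path_prob Q Q' : (forall x, Q x = Q' x) -> path_prob Q = path_prob Q'.
Proof. by move=> eqQ; congr path_prob; apply/funext. Qed.

Lemma path_prob0 Q : (forall x, Q x = false) -> path_prob Q = 0.
Proof.
move=> Q0; rewrite /path_prob (_ : path_event Q = set0) ?measure0 //.
by apply/seteqP; split=> // w; rewrite /path_event /= Q0.
Qed.

Lemma path_probE (n : nat) Q :
  depends_upto n Q -> P (path_event Q) = (path_prob Q)%:E.
Proof.
by move=> dQ; rewrite fineK // fin_num_measure //; apply: measurable_path_event dQ.
Qed.

Lemma path_prob_split (n : nat) Q B : depends_upto n Q -> depends_upto n B ->
  path_prob Q = path_prob (fun x => Q x && B x)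
              + path_prob (fun x => Q x && ~~ B x).
Proof.
move=> dQ dB; apply: EFin_inj.
have dQB := depends_upto_and dQ dB.
have dQnB := depends_upto_and dQ (depends_upto_neg dB).
rewrite EFinD -(path_probE dQ) -(path_probE dQB) -(path_probE dQnB).
rewrite -measureU; [|exact: measurable_path_event dQB
                    |exact: measurable_path_event dQnB|].
  congr (P _); apply/seteqP; split=> w; rewrite /path_event /=.
    by move=> ->; case: (B _); [left|right].
  by case=> /andP[].
apply/seteqP; split=> // w; rewrite /path_event /= => -[] /andP[_ ->].
by rewrite andbF.
Qed.

End PathProbability.

(** * One-step transitions of the chain *)

Section MarkovTrials.
Context (d : measure_display) (T : measurableType d) (R : realType).
Context (P : probability T R) (p alpha beta : R) (X : nat -> {RV P >-> bool}).
Hypothesis hX : markov_bernoulli_trials p alpha beta X.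
Local Notation pr := (path_prob X).

Definition transition (a b : bool) : R :=
  if a then (if b then alpha else 1 - alpha)
  else (if b then 1 - beta else beta).

(** The transitions 1 to 1 and 0 to 0 are given; the other two are complements under the same
    conditioning event. *)
Lemma cond_prob_transition (n : nat) (a b : bool) : (0 < n)%N ->
  P [set w | X n w = a] != 0%E ->
  cond_prob P [set w | X n.+1 w = b] [set w | X n w = a] = transition a b.
Proof.
move=> n_gt0 Pa; have [_ h1 h0 _] := hX.
have mX i c : measurable [set w | X i w = c] by exact: measurable_coord.
have compl : cond_prob P [set w | X n.+1 w = b] [set w | X n w = a] =
         1 - cond_prob P [set w | X n.+1 w = ~~ b] [set w | X n w = a].
  have fin A : measurable A -> P A \is a fin_num by exact: fin_num_measure.
  apply/eqP; rewrite eq_sym subr_eq eq_sym /cond_prob -mulrDl -fineD ?fin //;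
    try exact: measurableI.
  rewrite -measureU; [|exact: measurableI|exact: measurableI|].
    rewrite -setIUl (_ : _ `|` _ = setT) ?setTI; last first.
      apply/seteqP; split=> // w _ /=.
      by case: (X n.+1 w); case: b; [left|right|right|left].
    by rewrite divff // fine_eq0 ?fin.
  by apply/seteqP; split=> // w [[/= -> _] [/= + _]]; case: b.
have := h1 n.+1 n_gt0; have := h0 n.+1 n_gt0 => /= h0' h1'.
case: a b Pa compl => -[] Pa; rewrite /transition /=.
- by move=> _; exact: h1'.
- by rewrite (h1' Pa).
- by rewrite (h0' Pa).
- by move=> _; exact: h0'.
Qed.

(** The Markov property is assumed for complete histories only. An event of the first n trials is a
    finite disjoint union of such histories, and the identity is additive. Its product form also
    covers null events. *)
Lemma markov_step (n : nat) (Q : (nat -> bool) -> bool) (a b : bool) :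
  (0 < n)%N -> depends_upto n Q -> (forall x, Q x -> x n = a) ->
  pr (fun x => Q x && (x n.+1 == b)) = transition a b * pr Q.
Proof.
move=> n_gt0 dQ Qa.
(* Fix more and more of the first coordinates, until Q is a cylinder. *)
suff fixed r m (z : nat -> bool) : (m + r)%N = n -> forall Q',
    depends_upto n Q' -> (forall x, Q' x -> x n = a) ->
    (forall x, Q' x -> forall j, (1 <= j <= m)%N -> x j = z j) ->
    pr (fun x => Q' x && (x n.+1 == b)) = transition a b * pr Q'.
  by apply: (fixed n 0%N xpredT) => // x _ j; lia.
(* Here r counts the coordinates still free; the inductive step splits both sides on trial m + 1. *)
elim: r m z => [|r IHr] m z mn Q' dQ' Q'a Q'z; last first.
  have m_in : (1 <= m.+1 <= n)%N by lia.
  have dB := @depends_upto_coord n m.+1 true m_in.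
  have dN : depends_upto n.+1 Q'.
    by move=> x y eq_xy; apply: dQ' => j j_in; apply: eq_xy; lia.
  have dB' := @depends_upto_coord n.+1 m.+1 true ltac:(lia).
  have dE := @depends_upto_coord n.+1 n.+1 b ltac:(lia).
  rewrite (path_prob_split X (depends_upto_and dN dE) dB').
  rewrite (path_prob_split X dQ' dB) mulrDr; congr (_ + _).
    rewrite -(IHr m.+1 (fun j => if j == m.+1 then true else z j)); first last.
    - move=> x /andP[Q'x /eqP xm] j j_in; case: eqP => [->//|ne_j].
      by apply: Q'z => //; lia.
    - by move=> x /andP[/Q'a].
    - exact: depends_upto_and.
    - lia.
    - by apply: eq_path_prob => x; rewrite andbAC.
  rewrite -(IHr m.+1 (fun j => if j == m.+1 then false else z j)); first last.
  - move=> x /andP[Q'x xm] j j_in; case: eqP => [->|ne_j].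
      by case: (x m.+1) xm.
    by apply: Q'z => //; lia.
  - by move=> x /andP[/Q'a].
  - exact: depends_upto_and dQ' (depends_upto_neg dB).
  - lia.
  - by apply: eq_path_prob => x; rewrite andbAC.
(* All of the first n trials are now prescribed by [z], so [Q'] is either impossible or exactly the
   cylinder of [z]. *)
rewrite addn0 in mn; subst m.
have [Q'z1|nQ'z1] := boolP (Q' z); last first.
  have Q'0 x : Q' x = false.
    apply/negP => Q'x; apply: (negP nQ'z1).
    exact: (dQ' _ _ (Q'z _ Q'x) Q'x).
  by rewrite !path_prob0 ?mulr0 // => x; rewrite Q'0.
(* The Markov hypothesis reads the past and the next trial off one sequence, so [z] is given the
   value [b] at n + 1. *)
pose zb j := if j == n.+1 then b else z j.
have zb_n : zb n = a by rewrite /zb ltn_eqF // Q'a.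
have zb_n1 : zb n.+1 = b by rewrite /zb eqxx.
have zb_j j : (1 <= j <= n)%N -> zb j = z j.
  by move=> j_in; rewrite /zb; case: eqP => //; lia.
pose past := [set w | forall j : nat, (1 <= j < n.+1)%N -> X j w = zb j].
have pastE : path_event X Q' = past.
  apply/seteqP; split=> w; rewrite /path_event /past /=.
    by move=> /Q'z H j j_in; rewrite zb_j // H.
  by move=> H; apply: dQ' Q'z1 => j j_in; rewrite H // zb_j.
have mpast : measurable past by rewrite -pastE; exact: measurable_path_event dQ'.
rewrite /path_prob pastE (_ : path_event _ _ =
    [set w | X n.+1 w = b] `&` past); last first.
  rewrite -pastE; apply/seteqP; split=> w; rewrite /path_event /=.
    by move=> /andP[? /eqP].
  by move=> [-> ->]; rewrite eqxx.
have mX i c : measurable [set w | X i w = c] by exact: measurable_coord.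
(* For a null past both sides vanish. Otherwise the event that trial n equals [a], which contains
   the past, is not null either, and both conditional probabilities are meaningful. *)
have [P0|Pn0] := eqVneq (P past) 0%E.
  rewrite P0 mulr0 (subset_measure0 _ mpast _ P0) //; last exact: measurableI.
have Pa : P [set w | X n w = a] != 0%E.
  apply: contra_neq Pn0 => P0; apply: (subset_measure0 mpast (mX n a) _ P0).
  by move=> w /(_ n) /=; rewrite zb_n; apply; lia.
have [_ _ _ markov] := hX.
have := markov n.+1 zb n_gt0 Pn0.
rewrite /= zb_n zb_n1 cond_prob_transition // => <-.
by rewrite /cond_prob divfK // fine_eq0 // fin_num_measure.
Qed.

(** * The probabilities h_v of run starts and their recurrence *)

Section RunStarts.
Variables (k : nat).
Hypothesis k_gt0 : (0 < k)%N.

Definition run_start (v : nat) : R := pr (fresh_ones k 1 v).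

(** This value makes the terms of the later sums vanish when the truncated difference [n - i] is
    0. *)
Lemma run_start0 : run_start 0 = 0.
Proof. by apply: path_prob0 => x; rewrite fresh_ones_short. Qed.

(** Each of the m prolongations of the run is a transition from 1 to 1. If n <= m, no such run fits,
    and the right side vanishes by [run_start0]. *)
Lemma path_prob_fresh_ones (m n : nat) :
  pr (fresh_ones k m.+1 n) = alpha ^+ m * run_start (n - m).
Proof.
have [le_nm|lt_mn] := leqP n m.
  have -> : (n - m = 0)%N by lia.
  by rewrite run_start0 mulr0 path_prob0 // => x; rewrite fresh_ones_short.
elim: m n lt_mn => [|m IHm] [//|n] lt_mn; first by rewrite mul1r.
have -> : pr (fresh_ones k m.+2 n.+1) =
    pr (fun x => fresh_ones k m.+1 n x && (x n.+1 == true)).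
  by apply: eq_path_prob => x; rewrite fresh_onesS eqb_id.
rewrite (markov_step (a := true)); [|lia|exact: depends_upto_fresh_ones|].
  by rewrite IHm; [rewrite subSS exprS mulrA|lia].
by move=> x /and3P[_ _ /ones_run_atP[_]]; apply; lia.
Qed.

Lemma path_prob_fresh_zero (n : nat) : (0 < n)%N ->
  run_start n.+1 = (1 - beta) * pr (fresh_ones k 0 n).
Proof.
move=> n_gt0.
rewrite -(markov_step (n := n) (a := false) true) //.
- by apply: eq_path_prob => x; rewrite fresh_onesS eqb_id.
- exact: depends_upto_fresh_ones.
- by move=> x; rewrite fresh_ones0 // => /andP[_ /negbTE].
Qed.

(** The event is sorted by the exact length i + 1 of the run of ones ending at n, which is less than
    k. *)
Lemma path_prob_no_run_one (n : nat) : (0 < n)%N ->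
  pr (fun x => no_run k n x && x n) =
  \sum_(0 <= i < k - 1) alpha ^+ i * run_start (n - i).
Proof.
move=> n_gt0.
(* [S m] concerns at least m final ones, so consecutive differences give the exact lengths, and the
   sum telescopes from [S 1] to [S k], which is 0. *)
pose S m := pr (fun x => no_run k n x && ones_run_at m x n).
have S1 : S 1%N = pr (fun x => no_run k n x && x n).
  by apply: eq_path_prob => x; rewrite ones_run_at1.
have Sk : S k = 0.
  apply: path_prob0 => x; apply/negP => /andP[/no_runP/(_ n (leqnn n))].
  by move=> /negP.
have stepS m : (m.+1 < k)%N ->
    S m.+1 = S m.+2 + alpha ^+ m * run_start (n - m).
  move=> lt_mk; rewrite -path_prob_fresh_ones /S.
  have dr j := @depends_upto_ones_run n j n (leqnn n).
  rewrite (path_prob_split X (depends_upto_and (@depends_upto_no_run n k) (dr m.+1))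
    (dr m.+2)).
  by congr (_ + _); apply: eq_path_prob => x;
    rewrite (no_run_ones_longer, no_run_ones_fresh).
have S1j j : (j <= k - 1)%N -> S 1%N = S j.+1 +
    \sum_(0 <= i < j) alpha ^+ i * run_start (n - i).
  elim: j => [|j IHj] lt_jk; first by rewrite big_geq // addr0.
  by rewrite big_nat_recr //= IHj 1?ltnW // stepS; [ring|lia].
by rewrite -S1 (S1j _ (leqnn _)) (_ : (k - 1).+1 = k) ?Sk ?add0r //; lia.
Qed.

(** The zero at n + 1 completes no run, so only the absence of runs up to n matters. Splitting on
    trial n, the last transition contributes [beta] after a zero and [1 - alpha] after a one. *)
Lemma path_prob_fresh_zeroS (n : nat) : (0 < n)%N ->
  pr (fresh_ones k 0 n.+1) = beta * pr (fresh_ones k 0 n) +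
    (1 - alpha) * \sum_(0 <= i < k - 1) alpha ^+ i * run_start (n - i).
Proof.
move=> n_gt0; rewrite -path_prob_no_run_one //.
have dx : depends_upto n.+1 (fun x => x n == true).
  by apply: depends_upto_coord; lia.
have dxn : depends_upto n (fun x => x n == true).
  by apply: depends_upto_coord; lia.
rewrite (path_prob_split X (@depends_upto_fresh_ones n.+1 k 0) dx) addrC.
have freshE x : fresh_ones k 0 n.+1 x = no_run k n x && (x n.+1 == false).
  by rewrite fresh_ones0 // no_run_zeroE // eqbF_neg.
congr (_ + _).
  rewrite -(markov_step (n := n) (a := false) false) //.
  - apply: eq_path_prob => x; rewrite freshE fresh_ones0 //.
    by rewrite eqb_id andbAC.
  - exact: depends_upto_fresh_ones.
  - by move=> x; rewrite fresh_ones0 // => /andP[_ /negbTE].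
rewrite -(markov_step (n := n) (a := true) false) //.
- by apply: eq_path_prob => x; rewrite freshE eqb_id andbAC.
- apply: depends_upto_and (@depends_upto_no_run n k) _ => x y eq_xy.
  by rewrite eq_xy //; lia.
- by move=> x /andP[].
Qed.

Lemma run_start1 : run_start 1 = p.
Proof.
have [h1 _ _ _] := hX; rewrite /run_start /path_prob -[RHS]/(fine p%:E) -h1.
congr (fine (P _)); apply/seteqP; split=> w; rewrite /path_event /=.
  by move=> /and3P[_ _]; rewrite ones_run_at1.
move=> X1; apply/and3P; split=> //; last by rewrite ones_run_at1.
apply/no_runP => e le_e0; apply/negP => /andP[]; lia.
Qed.

Lemma run_start2 : run_start 2 = (1 - p) * (1 - beta).
Proof.
rewrite path_prob_fresh_zero // mulrC; congr (_ * _).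
have [h1 _ _ _] := hX; rewrite /path_prob -[p]/(fine p%:E) -h1.
have mX : measurable [set w | X 1%N w = true] by exact: measurable_coord.
rewrite -[1]/(fine 1%:E) -fineB ?fin_num_measure // -probability_setC //.
congr (fine (P _)); apply/seteqP; split=> w; rewrite /path_event /=.
  by rewrite fresh_ones0 // => /andP[_ /negP].
move=> /negP X1; rewrite fresh_ones0 // X1 andbT.
apply/no_runP => e le_e1; apply: contra X1 => /ones_run_atP[le_ke]; apply.
by lia.
Qed.

Lemma run_start_rec (n : nat) : (0 < n)%N ->
  run_start n.+2 = beta * run_start n.+1 + (1 - alpha) * (1 - beta) *
    \sum_(0 <= i < k - 1) alpha ^+ i * run_start (n - i).
Proof.
move=> n_gt0; rewrite !path_prob_fresh_zero // path_prob_fresh_zeroS //.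
by ring.
Qed.

Lemma run_recurrence_run_start : run_recurrence p alpha beta k run_start.
Proof.
have shift n m : \sum_(0 <= i < m) alpha ^+ i * run_start (n.+2 - i - 2)%N =
    \sum_(0 <= i < m) alpha ^+ i * run_start (n - i).
  by apply: eq_bigr => i _; congr (_ * run_start _); lia.
split; [exact: run_start1|exact: run_start2| |].
  case=> [|[|n]] // v_in; rewrite run_start_rec; last lia.
  rewrite shift (_ : (n.+2 - 2 = n)%N); last lia.
  (* For v = n + 2 <= k the sum of the recurrence stops at n; the terms with i >= n have index 0 and
     vanish. *)
  congr (_ + _ * _); rewrite (big_cat_nat (n := n)) //=; last lia.
  rewrite [X in _ + X]big_nat_cond [X in _ + X]big1 ?addr0 // => i.
  case/andP=> /andP[le_ni _] _; rewrite (_ : (n - i = 0)%N); last lia.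
  by rewrite run_start0 mulr0.
by case=> [|[|n]] // n_in _; rewrite run_start_rec ?shift.
Qed.

End RunStarts.
End MarkovTrials.

(** * Uniqueness of the solution and the law of the waiting time *)

Lemma run_recurrence_uniq (R : realType) (p alpha beta : R) (k : nat)
    (h h' : nat -> R) :
  run_recurrence p alpha beta k h -> run_recurrence p alpha beta k h' ->
  forall v, (0 < v)%N -> h v = h' v.
Proof.
move=> [h1 h2 h_le h_gt] [h1' h2' h_le' h_gt']; elim/ltn_ind => v IHv v_gt0.
have [v_le2|v_ge3] := ltnP v 3.
  have [->|->] : v = 1%N \/ v = 2%N by lia.
    by rewrite h1 h1'.
  by rewrite h2 h2'.
have eq_pred : h v.-1 = h' v.-1 by apply: IHv; lia.
(* The bound on m keeps every index v - i - 2 at least 1, so the arbitrary value [h 0] never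
   enters. *)
have eq_sum m : (m <= v - 2)%N ->
    \sum_(0 <= i < m) alpha ^+ i * h (v - i - 2)%N =
    \sum_(0 <= i < m) alpha ^+ i * h' (v - i - 2)%N.
  move=> le_m; apply: eq_big_nat => i i_in; congr (_ * _).
  by apply: IHv; lia.
have [le_vk|lt_kv] := leqP v k.
  have v_in : (3 <= v <= k)%N by rewrite v_ge3.
  by rewrite (h_le v v_in) (h_le' v v_in) eq_pred eq_sum.
have v_gt : (k + 1 <= v)%N by rewrite addn1.
by rewrite (h_gt v v_ge3 v_gt) (h_gt' v v_ge3 v_gt) eq_pred eq_sum //; lia.
Qed.

Theorem theorem2p13 (d : measure_display) (T : measurableType d)
    (R : realType) (P : probability T R) (p alpha beta : R)
    (X : nat -> {RV P >-> bool}) (k : nat)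
    (hX : markov_bernoulli_trials p alpha beta X)
    (hk : (1 <= k)%N) :
  (exists h : nat -> R, run_recurrence p alpha beta k h) /\
  (forall h : nat -> R, run_recurrence p alpha beta k h ->
     forall v : nat, (k <= v)%N ->
       P [set w | waiting_time k (fun i => X i w) = Some v] =
       (h (v - k + 1)%N * alpha ^+ (k - 1))%:E).
Proof.
have rec := run_recurrence_run_start hX hk.
split=> [|h rec_h v le_kv]; first by exists (run_start X k).
rewrite (_ : [set w | _] = path_event X (fresh_ones k k v)); last first.
  by apply/seteqP; split=> w; rewrite /path_event /= waiting_timeE.
rewrite (path_probE X (@depends_upto_fresh_ones v k k)); congr (_%:E).
(* The index v - k + 1 is positive, so [h] may be replaced there by [run_start]. *)
rewrite (run_recurrence_uniq rec_h rec) ?addn1 // mulrC.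
have := path_prob_fresh_ones hX hk (k - 1) v.
rewrite (_ : (k - 1).+1 = k); last by lia.
by rewrite (_ : (v - (k - 1))%N = (v - k).+1) //; lia.
Qed.
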